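(* Fix a prime power $q\geq 2$. Let $B_1,\dots,B_n\subseteq \mathbb{F}_q^n$ be independent uniformly random bases of the vector space $\mathbb{F}_q^n$ (each chosen uniformly at random among all bases of $\mathbb{F}_q^n$). Then, with probability $1-o(1)$ as $n\to \infty$, the multi-set $B_1\cup \dots\cup B_n$ can be partitioned into $n$ bases of $\mathbb{F}_q^n$ which are transversal with respect to $B_1,\dots,B_n$.
   Context: A basis $B\subseteq B_1\cup\dots\cup B_n$ (a sub-multiset of the multi-set union) is called transversal with respect to $B_1,\dots,B_n$ if it contains exactly one vector from each of $B_1,\dots,B_n$; here $B_1,\dots,B_n$ are regarded as subsets of the multi-set $B_1\cup\dots\cup B_n$, and if a vector appears in several of the bases, its copies in the multi-set are distinguished by which $B_i$ they come from. *)

(* Defs.v *)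
From HB Require Import structures.
From mathcomp Require Import all_boot all_order all_algebra.

Set Implicit Arguments.
Unset Strict Implicit.
Unset Printing Implicit Defensive.

Import GRing.Theory.
Local Open Scope ring_scope.

Definition is_basis (F : finFieldType) (n : nat) (s : seq 'rV[F]_n) : bool :=
  basis_of {:'rV[F]_n} s.

Definition bases (F : finFieldType) (n : nat) : {set {set 'rV[F]_n}} :=
  [set B : {set 'rV[F]_n} | is_basis (enum B)].

(* The pair (i, v) is the copy of v coming from B i, so that a vector lying in
   several of the B i has as many distinct copies. *)
Definition multi_union (F : finFieldType) (n : nat)
    (B : {ffun 'I_n -> {set 'rV[F]_n}}) : {set 'I_n * 'rV[F]_n} :=
  [set p : 'I_n * 'rV[F]_n | p.2 \in B p.1].

(* Intended for S \subset multi_union B: the copies in S that come from B i are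
   then exactly the p \in S with p.1 = i. *)
Definition transversal_basis (F : finFieldType) (n : nat)
    (S : {set 'I_n * 'rV[F]_n}) : bool :=
  is_basis [seq p.2 | p <- enum S] &&
  [forall i : 'I_n, #|[set p in S | p.1 == i]| == 1%N].

Definition transversal_partitionable (F : finFieldType) (n : nat)
    (B : {ffun 'I_n -> {set 'rV[F]_n}}) : bool :=
  [exists P : {set {set 'I_n * 'rV[F]_n}},
    [&& partition P (multi_union B), #|P| == n
      & [forall S in P, transversal_basis S]]].

Definition uniform_pmf (R : realFieldType) (T : finType) (A : {set T}) (x : T)
    : R :=
  if x \in A then #|A|%:R^-1 else 0.

(* The joint mass function of independent random variables is the product of
   their mass functions. *)
Definition prob_random_bases (R : realFieldType) (F : finFieldType) (n : nat)
    (E : pred {ffun 'I_n -> {set 'rV[F]_n}}) : R :=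
  \sum_(B | E B) \prod_(i < n) uniform_pmf R (bases F n) (B i).

(* Main.v *)
Require Import Defs.
From HB Require Import structures.
From mathcomp Require Import all_boot all_order all_fingroup all_algebra.
From mathcomp Require Import mxabelem zify.

(* Arrange the bases as the rows of an n x n grid, so that the columns have to
   become bases. The vectors of the first n/4 rows are left in random order:
   with high probability every column is then independent, and the column
   spans V_j are in general position, meaning that for every subspace U of
   codimension at most m = O(log n), fewer than t = O(log n) indices j have
   U + V_j different from the whole space.
   The later rows are arranged greedily: a row with basis A extends all the
   columns if the bipartite graph joining column j to the vectors of A outside
   V_j has a perfect matching. By Hall's theorem a failure yields sets T of
   columns and S of vectors with |T| + |S| = n + 1 and S inside the
   intersection of the V_j, j in T. This intersection is a proper subspace,
   and of codimension more than m as soon as |T| >= t, so the union bound over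
   S and T shows that a single row fails with probability at most n^-2.
   General position survives the enlargement of the V_j, hence the step can be
   repeated up to the last row.

   Bases are counted through the n! invertible matrices having them as row
   sets. At least a quarter of all the matrices are invertible, so the
   estimates are made for uniformly random matrices. *)

Set Implicit Arguments.
Unset Strict Implicit.
Unset Printing Implicit Defensive.

Import Order.TTheory GRing.Theory Num.Theory.
Local Open Scope nat_scope.

(** * Sums over lists *)

Section ListSum.

Variable T : finType.
Implicit Types (D : {set T}) (F G : seq T -> nat) (l : seq T).

(** Up to the factor [#|D| ^ r], this is an expectation over [r] independent uniform entries; the
    recursion exposes them one at a time. *)
Fixpoint lsum D r F : nat :=
  if r is r'.+1 then \sum_(a in D) lsum D r' (fun l => F (a :: l)) else F [::].

Lemma leq_lsum D r F G :
  (forall l, size l = r -> all [in D] l -> F l <= G l) ->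
  lsum D r F <= lsum D r G.
Proof.
elim: r F G => [|r IH] F G leFG /=; first exact: leFG.
apply: leq_sum => a aD; apply: IH => l sz_l lD.
by apply: leFG => /=; [rewrite sz_l | rewrite aD].
Qed.

Lemma lsum_sub D D' r F : D \subset D' -> lsum D r F <= lsum D' r F.
Proof.
move=> sDD'; elim: r F => [|r IH] F //=.
rewrite (big_setID D (A := D')) /= (setIidPr sDD').
by apply: leq_trans (leq_addr _ _); apply: leq_sum => a _; apply: IH.
Qed.

Lemma lsum_const D r c : lsum D r (fun=> c) = #|D| ^ r * c.
Proof.
elim: r => [|r IH] /=; first by rewrite mul1n.
by under eq_bigr do rewrite IH; rewrite sum_nat_const expnS mulnA.
Qed.

Lemma lsumD D r F G : lsum D r (fun l => F l + G l) = lsum D r F + lsum D r G.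
Proof.
elim: r F G => [|r IH] F G //=.
by rewrite -big_split /=; apply: eq_bigr => a _; rewrite IH.
Qed.

Lemma lsumMr D r F c : lsum D r (fun l => F l * c) = lsum D r F * c.
Proof.
elim: r F => [|r IH] F //=.
by rewrite big_distrl /=; apply: eq_bigr => a _; rewrite IH.
Qed.

Lemma lsum_sum D r (I : finType) (P : pred I) (F : I -> seq T -> nat) :
  lsum D r (fun l => \sum_(i | P i) F i l) = \sum_(i | P i) lsum D r (F i).
Proof.
elim: r F => [|r IH] F //=; rewrite exchange_big /=.
by apply: eq_bigr => a _; rewrite IH.
Qed.

Lemma lsum_cat D k r F :
  lsum D (k + r) F = lsum D k (fun l => lsum D r (fun l' => F (l ++ l'))).
Proof. by elim: k F => [|k IH] F //=; apply: eq_bigr => a _; rewrite IH. Qed.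

Lemma lsum_all D (P : pred T) r :
  lsum D r (fun l => all P l) = #|[set a in D | P a]| ^ r.
Proof.
elim: r => [|r IH] //=.
have eqF a : lsum D r (fun l => P a && all P l) = P a * #|[set a in D | P a]| ^ r.
  by case: (P a); rewrite ?mul1n -?IH // lsum_const muln0.
under eq_bigr do rewrite eqF.
rewrite -big_distrl /= expnS; congr (_ * _).
by rewrite -big_mkcondr /= sum1dep_card; apply: eq_card => a; rewrite !inE.
Qed.

Lemma lsum_tuple D r F :
  lsum D r F = \sum_(t : r.-tuple T | all [in D] t) F t.
Proof.
elim: r F => [|r IH] F /=.
  rewrite (big_pred1 [tuple]) // => t; by rewrite tuple0 /= eqxx.
under eq_bigr do rewrite IH.
rewrite pair_big_dep /=.
rewrite (reindex (fun t : r.+1.-tuple T => (thead t, behead_tuple t))) /=.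
  apply: eq_big => [t|t _]; by rewrite [in RHS](tuple_eta t).
exists (fun p : T * r.-tuple T => cons_tuple p.1 p.2) => [t _|[a t] _] /=.
  by rewrite [RHS]tuple_eta; apply: val_inj.
by congr (_, _); apply: val_inj.
Qed.

(** Union bound along an exposure process: as long as [Inv] holds, the next entry is bad with
    probability at most [1 / c], and a good entry leads to a state where [Inv] holds again. Hence
    some entry among [r] is bad with probability at most [r / c]. *)
Lemma lsum_union_bound (St : Type) D (Inv : nat -> St -> Prop)
    (ok : St -> pred (seq T)) (K c : nat) :
    (forall s, ok s [::]) ->
    (forall k s, k < K -> Inv k s -> exists Bad : {set T}, #|Bad| * c <= #|D| /\
      forall a, a \in D -> a \notin Bad ->
      exists s', Inv k.+1 s' /\ forall l, ok s' l -> ok s (a :: l)) ->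
  forall r k s, k + r <= K -> Inv k s ->
  lsum D r (fun l => ~~ ok s l) * c <= r * #|D| ^ r.
Proof.
move=> ok0 step; elim=> [|r IH] k s lekr Inv_s /=; first by rewrite ok0.
have [|Bad [leBad good]] := step k s _ Inv_s.
  by apply: leq_trans lekr; rewrite addnS ltnS leq_addr.
rewrite big_distrl /=.
(* After a bad entry every continuation may fail; after a good one the induction hypothesis
   applies. *)
apply: (@leq_trans (\sum_(a in D)
    ((a \in Bad) * (#|D| ^ r * c) + r * #|D| ^ r))).
  apply: leq_sum => a aD; have [aB|aB] := boolP (a \in Bad).
    rewrite mul1n; apply: leq_trans (leq_addr _ _); rewrite leq_mul2r.
    rewrite -[X in _ <= X]muln1 -lsum_const leq_lsum ?orbT // => l _ _.
    by case: (ok s (a :: l)).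
  have [s' [Inv_s' ok_s']] := good a aD aB.
  rewrite mul0n add0n; apply: leq_trans (IH _ _ _ Inv_s'); last by rewrite addSnnS.
  rewrite leq_mul2r leq_lsum ?orbT // => l _ _.
  by have := ok_s' l; case: (ok s' l) => [-> // | _]; apply: leq_b1.
have leS : (\sum_(a in D) (a \in Bad)) * c <= #|D|.
  apply: leq_trans leBad; rewrite leq_mul2r -big_mkcondr /= sum1dep_card.
  by rewrite subset_leq_card ?orbT //; apply/subsetP => a; rewrite inE => /andP[].
rewrite big_split /= sum_nat_const -big_distrl /= expnS mulSn (mulnCA #|D| r).
by rewrite leq_add2r mulnCA mulnC leq_mul2r leS orbT.
Qed.

End ListSum.

(** * Hall's theorem *)

(** Induction on [#|A|]. If a nonempty proper subset [S] is tight, [S] and [A :\: S] are matched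
    separately, the latter outside [N E S]. Otherwise any edge may be used and its endpoint deleted.
    The map [f0] is the answer for empty [A]. *)
Lemma hall_marriage (X Y : finType) (f0 : X -> Y) (E : X -> Y -> bool) (A : {set X}) :
    (forall S : {set X}, S \subset A ->
       #|S| <= #|[set y | [exists x in S, E x y]]|) ->
  exists f : X -> Y, {in A &, injective f} /\ {in A, forall x, E x (f x)}.
Proof.
have [n] := ubnP #|A|; elim: n => // n IH in E A * => leAn hallA.
pose N (E' : X -> Y -> bool) (S : {set X}) := [set y | [exists x in S, E' x y]].
have inN (E' : X -> Y -> bool) (S : {set X}) x y : x \in S -> E' x y -> y \in N E' S.
  by move=> xS Exy; rewrite inE; apply/existsP; exists x; rewrite xS.
have [-> | [a aA]] := set_0Vmem A.
  by exists f0; split=> x; rewrite inE.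
have [/existsP[S /and3P[sSA S0 leNS]]|noS] := boolP [exists S : {set X},
    [&& S \proper A, S != set0 & #|N E S| <= #|S|]].
  have [||f1 [f1I f1E]] := IH E S.
  - exact: leq_trans (proper_card sSA) leAn.
  - move=> S' sS'; apply: hallA; exact: subset_trans sS' (proper_sub sSA).
  have [||f2 [f2I f2E]] := IH (fun x y => E x y && (y \notin N E S)) (A :\: S).
  - rewrite cardsD (setIidPr (proper_sub sSA)).
    rewrite -ltnS; apply: leq_ltn_trans leAn; rewrite ltn_subrL card_gt0 S0 /=.
    by apply/card_gt0P; exists a.
  - move=> S'; rewrite subsetD => /andP[sS'A dis].
    (* Hall's condition survives on [A :\: S]: it holds for [S :|: S'], and [S] accounts for at most
       [#|S|] neighbours. *)
    rewrite -(leq_add2l #|S|).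
    have : #|S :|: S'| <= #|N E (S :|: S')|.
      by apply: hallA; rewrite subUset (proper_sub sSA).
    rewrite -cardsUI disjoint_sym in dis *;
      rewrite (disjoint_setI0 dis) cards0 addn0 => /leq_trans->//.
    apply: leq_trans (leq_add leNS (leqnn _)).
    rewrite -cardsUI; apply: leq_trans (leq_addr _ _).
    apply/subset_leq_card/subsetP => y; rewrite inE => /existsP[x /andP[xSS Exy]].
    rewrite inE; have [//|yN /=] := boolP (y \in N E S).
    apply: (inN _ _ x); last by rewrite Exy.
    by move: xSS; rewrite inE => /orP[xS|//]; rewrite (inN _ _ _ _ xS Exy) in yN.
  have f1N x : x \in S -> f1 x \in N E S by move=> xS; apply: inN (f1E x xS).
  have inD x : x \in A -> x \notin S -> x \in A :\: S by rewrite inE => -> ->.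
  exists (fun x => if x \in S then f1 x else f2 x); split=> [x y xA yA|x xA].
    have [xS|xS] := boolP (x \in S); have [yS|yS] := boolP (y \in S).
    - exact: f1I.
    - by move=> e; have /andP[_] := f2E y (inD _ yA yS); rewrite -e f1N.
    - by move=> e; have /andP[_] := f2E x (inD _ xA xS); rewrite e f1N.
    - by apply: f2I; apply: inD.
  have [xS|xS] := boolP (x \in S); first exact: f1E.
  by have /andP[] := f2E x (inD _ xA xS).
have [b Eab] : exists b, E a b.
  have := hallA [set a]; rewrite sub1set cards1 => /(_ aA)/card_gt0P[b].
  by rewrite inE => /existsP[x /andP[/set1P-> ?]]; exists b.
have [||f2 [f2I f2E]] := IH (fun x y => E x y && (y != b)) (A :\ a).
- by rewrite (cardsD1 a A) aA in leAn.
- move=> S sSA; have [-> | S0] := eqVneq S set0; first by rewrite cards0.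
  have pSA : S \proper A by apply: sub_proper_trans sSA (properD1 aA).
  move: noS => /existsPn/(_ S); rewrite pSA S0 /= -ltnNge => ltSN.
  rewrite -ltnS (leq_trans ltSN) // (cardsD1 b (N E S)).
  rewrite -add1n leq_add ?leq_b1 //.
  apply/subset_leq_card/subsetP => y;
    rewrite !inE => /andP[yb /existsP[x /andP[xS Exy]]].
  by apply/existsP; exists x; rewrite xS Exy.
have inD x : x \in A -> x != a -> x \in A :\ a by rewrite !inE => -> ->.
exists (fun x => if x == a then b else f2 x); split=> [x y xA yA|x xA].
  have [->|xa] := eqVneq x a; have [->|ya] := eqVneq y a => // e.
  - by have /andP[_] := f2E y (inD _ yA ya); rewrite e eqxx.
  - by have /andP[_] := f2E x (inD _ xA xa); rewrite e eqxx.
  - by apply: f2I e; apply: inD.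
have [-> //|xa] := eqVneq x a.
by have /andP[] := f2E x (inD _ xA xa).
Qed.

Lemma perm_or_empty_rectangle n (E : 'I_n -> 'I_n -> bool) :
  (exists s : 'S_n, forall j, E j (s j)) \/
  (exists T S : {set 'I_n}, [/\ T != set0, #|T| + #|S| = n.+1
     & forall j i, j \in T -> i \in S -> ~~ E j i]).
Proof.
pose N (T : {set 'I_n}) := [set i | [exists j in T, E j i]].
have [/forallP hallT|/forallPn[T]] := boolP [forall T : {set 'I_n}, #|T| <= #|N T|].
  left; have [|f [fI fE]] := @hall_marriage _ _ id E setT; first by move=> S _;
    apply: hallT.
  have fI' : injective f by move=> x y; apply: fI; rewrite inE.
  by exists (perm fI') => j; rewrite permE; apply: fE; rewrite inE.
rewrite -ltnNge => ltNT; right; exists T.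
have leT : #|T| <= n by rewrite -[X in _ <= X]card_ord max_card.
have : n.+1 - #|T| <= #|~: N T|.
  have := cardsC (N T); rewrite card_ord => defn.
  by rewrite leq_subLR -[X in X.+1]defn -addSn leq_add2r.
case/card_geqP=> s [us szs sub_s]; exists [set i in s]; split.
- by rewrite -card_gt0; apply: leq_ltn_trans ltNT.
- by rewrite cardsE (card_uniqP us) szs subnKC // leqW.
move=> j i jT; rewrite inE => /sub_s; rewrite inE; apply: contra => Eji.
by rewrite inE; apply/existsP; exists j; rewrite jT.
Qed.

(** * Counting matrices *)

Lemma leq_bin_expn n k : 'C(n, k) <= n ^ k.
Proof.
apply: (@leq_trans (n ^_ k)); first by rewrite -bin_ffact leq_pmulr ?fact_gt0.
elim: k => [//|k IH]; rewrite ffactnSr expnSr; exact: leq_mul IH (leq_subr _ _).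
Qed.

Lemma leq_wexp2r m n e : m <= n -> m ^ e <= n ^ e.
Proof. by case: e => // e le_mn; rewrite leq_exp2r. Qed.

Section MatrixCounting.

Variable F : finFieldType.
Local Notation q := #|F|.

Lemma card_F_gt1 : 1 < q. Proof. exact: card_finNzRing_gt1. Qed.

Lemma card_F_gt0 : 0 < q. Proof. exact: ltnW card_F_gt1. Qed.

Lemma expF_gt0 e : 0 < q ^ e. Proof. by rewrite expn_gt0 card_F_gt0. Qed.

Lemma leq_expF e f : e <= f -> q ^ e <= q ^ f.
Proof. by move=> le_ef; rewrite leq_exp2l ?card_F_gt1. Qed.

Definition GL n : {set 'M[F]_n} := [set A | A \in unitmx].

Lemma card_rowwise n m (D : 'I_n -> {set 'rV[F]_m}) :
  #|[set A : 'M_(n, m) | [forall i, row i A \in D i]]| = \prod_i #|D i|.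
Proof.
under [RHS]eq_bigr do rewrite -sum1_card.
rewrite bigA_distr_big_dep /= -sum1dep_card.
rewrite (reindex (fun A : 'M[F]_(n, m) => [ffun i => row i A])) /=.
  rewrite [RHS](eq_bigr (fun=> 1)) => [|A _]; last by rewrite big1.
  apply: eq_bigl => A; apply/forallP/familyP => rowsD i; move: (rowsD i);
    by rewrite ffunE.
exists (fun f : {ffun 'I_n -> 'rV[F]_m} => (\matrix_i f i)%R) => [A _|f _].
  by apply/row_matrixP => i; rewrite rowK ffunE.
by apply/ffunP => i; rewrite ffunE rowK.
Qed.

Lemma card_submx n (U : 'M[F]_n) :
  #|[set v : 'rV[F]_n | (v <= U)%MS]| = q ^ \rank U.
Proof. by rewrite -card_rowg; apply: eq_card => v; rewrite !inE. Qed.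

Lemma card_orthogonal n (x : 'cV[F]_n) :
  #|[set v : 'rV[F]_n | v *m x == 0]%R| = q ^ (n - (x != 0%R)).
Proof.
have -> : [set v : 'rV[F]_n | v *m x == 0]%R = [set v | (v <= kermx x)%MS].
  by apply/setP => v; rewrite !inE sub_kermx.
by rewrite card_submx mxrank_ker -mxrank_tr rank_rV -trmx0 (inj_eq trmx_inj).
Qed.

(** A matrix of rank at most [m] factors through dimension [m]; the factors come from the Gaussian
    decomposition, padded with zeros. *)
Lemma card_mxrank_le n m :
  #|[set X : 'M[F]_n | \rank X <= m]| <= q ^ (2 * (n * m)).
Proof.
pose f (p : 'M[F]_(n, m) * 'M[F]_(m, n)) := (p.1 *m p.2)%R.
have -> : 2 * (n * m) = n * m + m * n by rewrite mulnC (mulnC m) muln2 addnn.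
rewrite expnD -!(card_mx F) -card_prod -cardsT.
apply: leq_trans (leq_imset_card f _); apply/subset_leq_card/subsetP => X.
rewrite inE => rkX; apply/imsetP.
exists (col_ebase X *m pid_mx (\rank X), pid_mx (\rank X) *m row_ebase X)%R => //.
rewrite /f /= mulmxA -(mulmxA (col_ebase X)) mul_pid_mx.
by rewrite (minn_idPr _) (minn_idPl _) ?mulmx_ebase // ?leqnn.
Qed.

(** The density of invertible matrices is the product of the [1 - q ^ -i], which is at least
    [1 / 4], hence at least [q ^ -2], a form that combines with the other powers of [q]. *)
Lemma card_GL_lower n : 0 < n -> q ^ (n * n) <= #|GL n| * q ^ 2.
Proof.
move=> n_gt0.
have -> : #|GL n| = q ^ 'C(n, 2) * \prod_(1 <= i < n.+1) (q ^ i - 1).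
  rewrite -card_GL //; case: n n_gt0 => // n _.
  by rewrite cardsT /= card_sub; apply: eq_card => A; rewrite !inE.
have -> : n * n = 'C(n, 2) + 'C(n.+1, 2).
  by elim: (n) => // m; rewrite !binS !bin1 ?bin0; lia.
rewrite expnD -mulnA leq_mul2l; apply/orP; right.
apply: (@leq_trans (4 * \prod_(1 <= i < n.+1) (q ^ i - 1))); last first.
  by rewrite mulnC leq_mul2l -[4]/(2 ^ 2) leq_exp2r // card_F_gt1 orbT.
have q1 := card_F_gt1.
(* the factor [1 + 2 / q ^ n] makes the induction go through *)
have : q ^ 'C(n.+1, 2) * (q ^ n + 2)
    <= 4 * \prod_(1 <= i < n.+1) (q ^ i - 1) * q ^ n.
  case: n n_gt0 => // n _; elim: n => [|n IH].
    rewrite big_nat1 !binS !bin1 ?bin0 /= !expn1; move: q1; clear.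
    by case: #|F| => // x; nia.
  rewrite big_nat_recr //= binS bin1 expnD.
  have X1 : 1 < q ^ n.+1 by rewrite -(expn0 q) ltn_exp2l.
  move: IH; rewrite [q ^ n.+2]expnS;
    move: (q ^ _) (\prod_(_ <= _ < _) _) (q ^ n.+1) X1 => Q P X X1 IH.
  apply: (@leq_trans (Q * (X + 2) * (q * (q * X - 1)))); last first.
    by apply: leq_trans (leq_mul IH (leqnn _)) _; apply: eq_leq; lia.
  rewrite -!mulnA leq_mul2l; apply/orP; right.
  have : 0 < q * X by nia.
  move: q1 X1; clear; case: #|F| => // p; nia.
move=> le1; rewrite -(leq_pmul2r (expF_gt0 n)); apply: leq_trans le1.
by rewrite leq_mul2l leq_addr orbT.
Qed.

End MatrixCounting.

(** * Greedy arrangement of matrix rows *)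

Lemma card_bigcup_leq (I T : finType) (P : pred I) (S : I -> {set T}) :
  #|\bigcup_(i | P i) S i| <= \sum_(i | P i) #|S i|.
Proof.
elim/big_rec2: _ => [|i c U _ leUc]; first by rewrite cards0.
by apply: leq_trans (leq_card_setU _ _) _; rewrite leq_add2l.
Qed.

Lemma card_subset_pairs (T : finType) a b :
  #|[set p : {set T} * {set T} | (#|p.1| == a) && (#|p.2| == b)]|
    = 'C(#|T|, a) * 'C(#|T|, b).
Proof.
by rewrite -!card_draws -cardsX; apply: eq_card => p; rewrite !inE.
Qed.

Section Arrangement.

Variables (F : finFieldType) (n : nat).
Local Notation q := #|F|.
Implicit Types (V : 'I_n -> 'M[F]_n) (A U X : 'M[F]_n) (l : seq 'M[F]_n).

(** [V j] is the span of the vectors already placed in column [j], and [s j] is the index of the row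
    of [A] placed there next. *)
Definition fits (s : 'S_n) A V := [forall j, ~~ (row (s j) A <= V j)%MS].

Definition add_rows (s : 'S_n) A V : 'I_n -> 'M[F]_n :=
  fun j => (V j + <<row (s j) A>>)%MS.

Fixpoint arrangeable V l : bool :=
  if l is A :: l' then
    [exists s : 'S_n, fits s A V && arrangeable (add_rows s A V) l']
  else true.

Fixpoint fits_unpermuted V l : bool :=
  if l is A :: l' then fits 1 A V && fits_unpermuted (add_rows 1 A V) l'
  else true.

Fixpoint stack_unpermuted V l : 'I_n -> 'M[F]_n :=
  if l is A :: l' then stack_unpermuted (add_rows 1 A V) l' else V.

(* The columns of X are functionals x_j vanishing on V_j, and rank X <= m says
   that they all vanish on a common subspace of codimension at most m. *)
Definition in_general_position m t V :=
  [forall X : 'M[F]_n, (\rank X <= m) && [forall j, V j *m col j X == 0]%R ==>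
     (#|[set j | col j X != 0]%R| < t)].

Lemma rank_add_rows s A V k :
    fits s A V -> (forall j, \rank (V j) = k) ->
  forall j, \rank (add_rows s A V j) = k.+1.
Proof.
move=> /forallP fit rkV j; apply/eqP; rewrite eqn_leq; apply/andP; split.
  apply: leq_trans (mxrank_adds_leqif _ _).1 _.
  by rewrite rkV -[k.+1]addn1 leq_add2l mxrank_gen rank_rV leq_b1.
rewrite -(rkV j) (ltn_leqif (mxrank_leqif_sup (addsmxSl _ _))).
apply: contra (fit j) => /(submx_trans (addsmxSr _ _)).
by rewrite genmxE.
Qed.

(** Functionals vanishing on the enlarged spans also vanish on the old ones. *)
Lemma general_position_add_rows m t s A V :
  in_general_position m t V -> in_general_position m t (add_rows s A V).
Proof.
move=> /forallP genV; apply/forallP => X; apply/implyP => /andP[rkX /forallP VX].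
apply: (implyP (genV X)); rewrite rkX; apply/forallP => j.
have [B ->] := submxP (addsmxSl (V j) <<row (s j) A>>%MS : (_ <= add_rows s A V j)%MS).
by rewrite -mulmxA (eqP (VX j)) mulmx0.
Qed.

(** * Matrices that cannot extend the columns *)

Lemma card_rows_in U (S : {set 'I_n}) :
  #|[set A | [forall i in S, (row i A <= U)%MS]]| * q ^ (#|S| * (n - \rank U))
    = q ^ (n * n).
Proof.
have leS : #|S| <= n by rewrite -[X in _ <= X]card_ord max_card.
have leU := rank_leq_row U.
transitivity (#|[set A : 'M[F]_n | [forall i, row i A \in
    [set v | (i \in S) ==> (v <= U)%MS]]]| * q ^ (#|S| * (n - \rank U))).
  by congr (_ * _); apply: eq_card => A; rewrite !inE; apply: eq_forallb => i;
    rewrite inE.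
rewrite card_rowwise (bigID [in S]) /=.
rewrite (eq_bigr (fun=> q ^ \rank U)) => [|i iS]; last first.
  by rewrite -card_submx; apply: eq_card => v; rewrite !inE iS.
rewrite [X in _ * X * _](eq_bigr (fun=> q ^ n)) => [|i iS]; last first.
  rewrite -[n in RHS]mul1n -card_mx -cardsT; apply: eq_card => v.
  by rewrite !inE (negPf iS).
have cardCS : #|[predC S]| = n - #|S|.
  by have := cardC S; rewrite card_ord; lia.
rewrite !prod_nat_const cardCS -!expnM -!expnD; congr (_ ^ _).
move: (#|S|) (\rank U) leS leU => a r lea ler.
have := leq_mul (leqnn a) ler; have := leq_mul (leqnn n) lea.
rewrite !mulnBr (mulnC r a) (mulnC a n); lia.
Qed.

Lemma exists_nonzero_annihilated U :
  \rank U < n -> exists x : 'cV[F]_n, (x != 0 /\ U *m x = 0)%R.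
Proof.
move=> ltU.
have : cokermx U != 0%R by rewrite -mxrank_eq0 mxrank_coker; lia.
have [j xj _|col0] := pickP (fun j => col j (cokermx U) != 0%R).
  by exists (col j (cokermx U)); rewrite colE mulmxA mulmx_coker mul0mx -colE.
case/eqP; apply/matrixP => i j; have /negbFE/eqP/matrixP/(_ i 0%R) := col0 j.
by rewrite !mxE.
Qed.

(** For each [j] in [T] take a nonzero functional vanishing on [V j] as column [j] of [X], with zero
    columns elsewhere. [X] kills the intersection, so codimension at most [m] would give
    [\rank X <= m] with [#|T| >= t] nonzero columns. *)
Lemma rank_bigcap_general_position m t V (T : {set 'I_n}) :
    (forall j, \rank (V j) < n) -> in_general_position m t V -> t <= #|T| ->
  \rank (\bigcap_(j in T) V j)%MS + m < n.
Proof.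
move=> ltV genV leT; rewrite ltnNge; apply: contraL leT => leU.
have /fin_all_exists[x xP] : forall j, exists x : 'cV[F]_n, (x != 0 /\ V j *m x = 0)%R.
  by move=> j; apply: exists_nonzero_annihilated.
set U := (\bigcap_(j in T) V j)%MS in leU *.
pose X : 'M[F]_n := (\matrix_(i, j) if j \in T then x j i 0 else 0)%R.
have colX j : col j X = if j \in T then x j else 0%R.
  by apply/colP => i; rewrite !mxE; case: ifP => // _; rewrite mxE.
have VX j : (V j *m col j X = 0)%R.
  by rewrite colX; case: ifP => _; [have [] := xP j | rewrite mulmx0].
have UX : (U *m X = 0)%R.
  apply/matrixP => i j; rewrite [RHS]mxE.
  transitivity ((U *m col j X) i 0)%R.
    by rewrite !mxE; apply: eq_bigr => k _; rewrite !mxE.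
  have [jT|jT] := boolP (j \in T); last first.
    by rewrite colX (negPf jT) mulmx0 mxE.
  have [B ->] := submxP (bigcapmx_inf j jT (submx_refl (V j)) : (U <= V j)%MS).
  by rewrite -mulmxA VX mulmx0 mxE.
rewrite -ltnNge.
have -> : T = [set j | col j X != 0%R].
  apply/setP => j; rewrite inE colX; case: ifP => _; last by rewrite eqxx.
  by have [-> _] := xP j.
apply: (implyP (forallP genV X)); apply/andP; split; last first.
  by apply/forallP => j; rewrite VX.
by have := mulmx0_rank_max UX; lia.
Qed.

(** Union bound over the Hall obstructions with [#|T| = u] and [#|S| = n.+1 - u]. For [u < t] there
    are few pairs and each of the many rows in [S] costs a factor [q]; for [u >= t] general position
    makes each row cost [q ^ m.+1]. *)
Lemma card_unfitting V k m t L :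
    k < n -> (forall j, \rank (V j) = k) -> in_general_position m t V ->
    n <= q ^ L -> 5 * L + 2 <= m -> (2 * L + 1) * t + 3 * L + 1 <= n ->
  #|[set A | ~~ [exists s : 'S_n, fits s A V]]| * q ^ (2 * L) <= #|GL F n|.
Proof.
move=> ltkn rkV genV len lem ltn.
have rkV_lt j : \rank (V j) < n by rewrite rkV.
have q0 := expF_gt0 F.
pose cap (T : {set 'I_n}) := (\bigcap_(j in T) V j)%MS.
pose R (p : {set 'I_n} * {set 'I_n}) :=
  [set A | [forall i in p.2, (row i A <= cap p.1)%MS]].
pose P u (p : {set 'I_n} * {set 'I_n}) :=
  [&& p.1 != set0, #|p.1| == u & #|p.2| == n.+1 - u].
have sub : [set A | ~~ [exists s : 'S_n, fits s A V]]
    \subset \bigcup_(u < n.+1) \bigcup_(p | P u p) R p.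
  apply/subsetP => A; rewrite inE => noA.
  have [[s fit]|[T [S [T0 cTS noE]]]] :=
      perm_or_empty_rectangle (fun j i => ~~ (row i A <= V j)%MS).
    by case/existsP: noA; exists s; apply/forallP.
  have ltT : #|T| < n.+1 by rewrite ltnS -[X in _ <= X]card_ord max_card.
  apply/bigcupP; exists (Ordinal ltT) => //; apply/bigcupP; exists (T, S).
    by rewrite /P /= T0 eqxx -cTS addKn eqxx.
  rewrite inE; apply/forall_inP => i iS; apply/sub_bigcapmxP => j jT.
  by have := noE j i jT iS; rewrite negbK.
(* The factor [q ^ 2] pays for passing from all matrices to invertible ones, the next factor [q ^ L]
   for the sum over [u]. *)
rewrite -(leq_pmul2r (q0 2)) -mulnA -expnD.
apply: leq_trans (card_GL_lower F _); last by lia.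
rewrite -(leq_pmul2r (q0 L)) -mulnA -expnD.
have -> : 2 * L + 2 + L = 3 * L + 2 by lia.
(* The factor [(0 < u)] discards [u = 0], leaving [n <= q ^ L] terms. *)
suffices bound (u : 'I_n.+1) :
    (\sum_(p | P u p) #|R p|) * q ^ (3 * L + 2) <= (0 < u) * q ^ (n * n).
  apply: (@leq_trans (\sum_(u < n.+1) (0 < u) * q ^ (n * n))).
    apply: leq_trans (leq_mul (subset_leq_card sub) (leqnn _)) _.
    apply: leq_trans (leq_mul (card_bigcup_leq _ _) (leqnn _)) _.
    rewrite big_distrl /=; apply: leq_sum => u _; apply: leq_trans (bound u).
    by rewrite leq_mul2r card_bigcup_leq orbT.
  rewrite big_ord_recl mul0n add0n; under eq_bigr do rewrite mul1n.
  by rewrite sum_nat_const card_ord mulnC leq_mul2l len orbT.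
have [u0|u_gt0] := posnP u.
  rewrite big_pred0 // => p; apply/negP => /and3P[p0].
  by rewrite u0 cards_eq0 (negPf p0).
have leun : u <= n by rewrite -ltnS.
rewrite mul1n.
(* A single obstruction has probability at most [q ^ -c], and there are at most [q ^ e] of them. *)
pose c := if u < t then n.+1 - u else (n.+1 - u) * m.+1.
pose e := if u < t then 2 * u * L else 2 * (n.+1 - u) * L.
have le_ec : e + (3 * L + 2) <= c.
  rewrite /e /c; case: ltnP => [ltut|letu]; first by nia.
  have : 0 < n.+1 - u by rewrite subn_gt0.
  by move: (n.+1 - u) => x x0; nia.
have card_P : #|[set p | P u p]| <= q ^ e.
  apply: (@leq_trans ('C(n, u) * 'C(n, n.+1 - u))).
    have := card_subset_pairs 'I_n u (n.+1 - u); rewrite card_ord => <-.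
    apply/subset_leq_card/subsetP => p.
    by rewrite !inE => /and3P[_ -> ->].
  rewrite /e; case: ltnP => _.
    (* For small [T] the set [S] is chosen through its complement, of size [u.-1]. *)
    have -> : 'C(n, n.+1 - u) = 'C(n, u.-1).
      by rewrite -[RHS]bin_sub; [congr ('C(_, _)); lia | lia].
    apply: leq_trans (leq_mul (leq_bin_expn _ _) (leq_bin_expn _ _)) _.
    rewrite -expnD; apply: leq_trans (_ : (q ^ L) ^ (u + u.-1) <= _).
      exact: leq_wexp2r.
    by rewrite -expnM leq_expF //; nia.
  rewrite -(bin_sub leun).
  apply: leq_trans (leq_mul (leq_bin_expn _ _) (leq_bin_expn _ _)) _.
  rewrite -expnD; apply: leq_trans (_ : (q ^ L) ^ (n - u + (n.+1 - u)) <= _).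
    exact: leq_wexp2r.
  by rewrite -expnM leq_expF //; nia.
have card_R p : P u p -> #|R p| * q ^ c <= q ^ (n * n).
  case/and3P => p0 /eqP szT /eqP szS; rewrite -(card_rows_in (cap p.1) p.2).
  rewrite leq_mul2l leq_expF ?orbT // szS /c; case: ltnP => [_|letu].
    have [j jT] := set0Pn _ p0.
    have : \rank (cap p.1) <= k.
      by rewrite -(rkV j) mxrankS // (bigcapmx_inf j jT).
    by move=> ?; nia.
  have := rank_bigcap_general_position rkV_lt genV (_ : t <= #|p.1|).
  rewrite szT => /(_ letu); rewrite -/(cap _) => lt_cap.
  by rewrite leq_mul2l; lia.
rewrite -(leq_pmul2r (q0 e)) -mulnA -expnD addnC.
apply: (@leq_trans ((\sum_(p | P u p) #|R p|) * q ^ c)).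
  by rewrite leq_mul2l leq_expF ?orbT.
rewrite big_distrl /= mulnC; apply: (@leq_trans (\sum_(p | P u p) q ^ (n * n))).
  exact: leq_sum.
by rewrite sum_nat_cond_const leq_mul2r card_P orbT.
Qed.

Lemma lsum_not_arrangeable k r V m t L :
    k + r <= n -> (forall j, \rank (V j) = k) -> in_general_position m t V ->
    n <= q ^ L -> 5 * L + 2 <= m -> (2 * L + 1) * t + 3 * L + 1 <= n ->
  lsum (GL F n) r (fun l => ~~ arrangeable V l) * q ^ (2 * L)
    <= r * #|GL F n| ^ r.
Proof.
move=> lekr rkV genV len lem ltn.
apply: (@lsum_union_bound _ _ _
  (fun k V => (forall j, \rank (V j) = k) /\ in_general_position m t V)
  arrangeable n _ _ _ r k V) => // {k V lekr rkV genV} k V ltkn [rkV genV].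
exists [set A | ~~ [exists s : 'S_n, fits s A V]].
split; first exact: card_unfitting ltkn rkV genV len lem ltn.
move=> A _; rewrite inE negbK => /existsP[s fit]; exists (add_rows s A V).
split; first by split; [exact: rank_add_rows | exact: general_position_add_rows].
by move=> l ok_l; apply/existsP; exists s; rewrite fit.
Qed.

(** * The first rows, kept in random order *)

Lemma lsum_not_fits_unpermuted k V L :
    k + 3 * L + 2 <= n -> (forall j, \rank (V j) = 0) -> n <= q ^ L ->
  lsum (GL F n) k (fun l => ~~ fits_unpermuted V l) * q ^ (2 * L)
    <= k * #|GL F n| ^ k.
Proof.
move=> lek rkV len.
apply: (@lsum_union_bound _ _ _ (fun k V => forall j, \rank (V j) = k)
  fits_unpermuted k _ _ _ k 0 V) => // {V rkV} i V ltik rkV.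
have q0 := expF_gt0 F.
exists [set A | ~~ fits 1 A V]; split; last first.
  move=> A _; rewrite inE negbK => fit; exists (add_rows 1 A V).
  by split=> [|l ok_l]; [apply: rank_add_rows | rewrite /= fit].
(* A failure puts some row [j] into [V j], of rank [i < k]. Its codimension exceeds [3 * L + 2],
   which pays for the choice of [j], for the density of [GL F n] and for [q ^ (2 * L)]. *)
have sub : [set A | ~~ fits 1 A V]
    \subset \bigcup_j [set A | [forall i in [set j], (row i A <= V j)%MS]].
  apply/subsetP => A; rewrite inE => /forallPn[j]; rewrite negbK perm1 => AV.
  apply/bigcupP; exists j => //; rewrite inE.
  by apply/forall_inP => _ /set1P->.
rewrite -(leq_pmul2r (q0 2)) -mulnA -expnD.
apply: leq_trans (card_GL_lower F _); last by lia.
rewrite -(leq_pmul2r (q0 L)) -mulnA -expnD.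
apply: leq_trans (leq_mul (subset_leq_card sub) (leqnn _)) _.
apply: leq_trans (leq_mul (card_bigcup_leq _ _) (leqnn _)) _.
rewrite big_distrl /=; apply: (@leq_trans (\sum_(j < n) q ^ (n * n))).
  apply: leq_sum => j _; rewrite -(card_rows_in (V j) [set j]) cards1 rkV.
  by rewrite leq_mul2l leq_expF ?orbT //; lia.
by rewrite sum_nat_const card_ord mulnC leq_mul2l len orbT.
Qed.

(** The conditions on different rows are independent, and each nonzero column of [X] costs a factor
    [q]. *)
Lemma card_diagonal_orthogonal X :
  #|[set A | [forall j, row j A *m col j X == 0]%R]|
    * q ^ #|[set j | col j X != 0]%R| = q ^ (n * n).
Proof.
transitivity (#|[set A : 'M[F]_n | [forall j, row j A \in
    [set v : 'rV[F]_n | v *m col j X == 0]%R]]| * q ^ #|[set j | col j X != 0]%R|).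
  by congr (_ * _); apply: eq_card => A; rewrite !inE; apply: eq_forallb => j;
    rewrite inE.
rewrite card_rowwise; under eq_bigr do rewrite card_orthogonal.
rewrite -sum1dep_card expn_sum [X in _ * X = _]big_mkcond -big_split /=.
rewrite -[in RHS](card_ord n) -sum_nat_const expn_sum.
rewrite card_ord; apply: eq_bigr => j _.
by case: eqP => _ /=; rewrite ?muln1 -?expnD; congr (_ ^ _); have := ltn_ord j; lia.
Qed.

Lemma sub_stack_unpermuted V l j : (V j <= stack_unpermuted V l j)%MS.
Proof.
elim: l V => [|A l IH] V /=; first exact: submx_refl.
exact: submx_trans (addsmxSl _ _) (IH _).
Qed.

Lemma row_stack_unpermuted V l A j :
  A \in l -> (row j A <= stack_unpermuted V l j)%MS.
Proof.
elim: l V => [//|B l IH] V; rewrite inE => /predU1P[->|Al] /=; last exact: IH.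
apply: submx_trans (sub_stack_unpermuted _ _ _).
by apply: submx_trans (addsmxSr _ _); rewrite perm1 genmxE.
Qed.

(** Union bound over the at most [q ^ (2 * (n * m))] witnesses [X]: all [k] matrices must satisfy
    the orthogonality conditions of [X], which has probability at most [q ^ -(t * k)] for arbitrary
    matrices. Restricting to invertible ones costs [q ^ (2 * k)]. *)
Lemma lsum_not_general_position k m t V L :
    0 < n -> 2 * (n * m) + 2 * k + L <= t * k ->
  lsum (GL F n) k (fun l => ~~ in_general_position m t (stack_unpermuted V l))
    * q ^ L <= #|GL F n| ^ k.
Proof.
move=> n_gt0 le_exp; have q0 := expF_gt0 F.
pose P X A := [forall j, row j A *m col j X == 0]%R.
pose bad X := (\rank X <= m) && (t <= #|[set j | col j X != 0]%R|).
have le1 : lsum (GL F n) k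
    (fun l => ~~ in_general_position m t (stack_unpermuted V l))
    <= \sum_(X | bad X) #|[set A | P X A]| ^ k.
  apply: leq_trans (lsum_sub _ _ (subsetT _)) _.
  rewrite [X in _ <= X](eq_bigr (fun X => lsum setT k (fun l => all (P X) l)));
    last first.
    by move=> X _; rewrite lsum_all; congr (_ ^ _); apply: eq_card => A; rewrite !inE.
  rewrite -lsum_sum; apply: leq_lsum => l _ _.
  have [//|/forallPn[X]] := boolP (in_general_position _ _ _).
  rewrite negb_imply -leqNgt -andbA => /and3P[rkX /forallP VX ltX].
  rewrite (bigD1 X) /=; last by rewrite /bad rkX.
  rewrite (_ : all _ _) //; apply/allP => A Al; apply/forallP => j.
  have [B ->] := submxP (row_stack_unpermuted V j Al).
  by rewrite -mulmxA (eqP (VX j)) mulmx0.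
rewrite -(leq_pmul2r (q0 (2 * k))) -mulnA -expnD.
rewrite -(leq_pmul2r (q0 (2 * (n * m)))) -mulnA -expnD.
apply: (@leq_trans ((\sum_(X | bad X) #|[set A | P X A]| ^ k) * q ^ (t * k))).
  by apply: leq_mul le1 _; apply: leq_expF; lia.
apply: (@leq_trans (q ^ (2 * (n * m)) * (q ^ (n * n)) ^ k)); last first.
  rewrite [X in X <= _]mulnC leq_mul2r (expnM q 2 k) -expnMn; apply/orP; right.
  exact: leq_wexp2r (card_GL_lower F n_gt0).
rewrite big_distrl /=.
apply: (@leq_trans (\sum_(X | bad X) (q ^ (n * n)) ^ k)).
  apply: leq_sum => X /andP[_ letX]; rewrite (expnM q t) -expnMn.
  apply: leq_wexp2r; rewrite -(card_diagonal_orthogonal X).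
  by rewrite leq_mul2l leq_expF ?orbT.
rewrite sum_nat_cond_const leq_mul2r; apply/orP; right.
apply: leq_trans (card_mxrank_le F n m).
by apply/subset_leq_card/subsetP => X; rewrite !inE => /andP[].
Qed.

Lemma rank_stack_unpermuted V l k :
    fits_unpermuted V l -> (forall j, \rank (V j) = k) ->
  forall j, \rank (stack_unpermuted V l j) = k + size l.
Proof.
elim: l V k => [|A l IH] V k /=; first by rewrite addn0.
move=> /andP[fit fit_l] rkV; rewrite -addSnnS; apply: IH => //.
exact: rank_add_rows.
Qed.

Lemma arrangeable_cat V l l' :
    fits_unpermuted V l -> arrangeable (stack_unpermuted V l) l' ->
  arrangeable V (l ++ l').
Proof.
elim: l V => [//|A l IH] V /= /andP[fit fit_l] arr.
by apply/existsP; exists 1%g; rewrite fit IH.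
Qed.

Lemma lsum_not_arrangeable0 L :
    0 < L -> n <= q ^ L -> 1024 * (L * L) <= n ->
  lsum (GL F n) n (fun l => ~~ arrangeable (fun=> 0%R) l) * n <= 2 * #|GL F n| ^ n.
Proof.
move=> L_gt0 len leL.
(* The first k rows are not permuted. There are at most [q ^ (2 * n * m)]
   matrices X of rank at most m, so general position after k rows needs
   [t * k] to exceed [2 * n * m]. *)
pose m := 7 * L; pose t := 10 * m + 3; pose k := n %/ 4; pose r := n - k.
pose V0 : 'I_n -> 'M[F]_n := fun=> 0%R.
have rkV0 j : \rank (V0 j) = 0 by rewrite mxrank0.
have n_gt0 : 0 < n by nia.
have lek : 4 * k <= n by rewrite /k; lia.
have lek' : n <= 4 * k + 3 by rewrite /k; lia.
have defn : n = k + r by rewrite /r; lia.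
have leLn : L <= k by nia.
have le3L : k + 3 * L + 2 <= n by nia.
have le5L : 5 * L + 2 <= m by rewrite /m; lia.
have let_n : (2 * L + 1) * t + 3 * L + 1 <= n.
  by rewrite /t /m; nia.
have le_exp : 2 * (n * m) + 2 * k + L <= t * k.
  rewrite /t mulnDl; have : 2 * (n * m) <= 10 * m * k by nia.
  by lia.
clearbody m t k r.
pose G := #|GL F n|.
have bad1 := lsum_not_fits_unpermuted le3L rkV0 len.
have bad2 := lsum_not_general_position V0 n_gt0 le_exp.
have q0 := expF_gt0 F.
(* A sum of booleans: positive if either failure occurs, and linear under [lsum]. *)
pose bad l := ~~ fits_unpermuted V0 l
  + ~~ in_general_position m t (stack_unpermuted V0 l).
have bad_or_late l : size l = k ->
    lsum (GL F n) r (fun l' => ~~ arrangeable V0 (l ++ l')) * q ^ (2 * L)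
    <= bad l * (G ^ r * q ^ (2 * L)) + r * G ^ r.
  move=> szl; have [badl|] := posnP (bad l); last first.
    move=> bad_gt0; apply: leq_trans (leq_addr _ _); rewrite mulnA leq_mul2r.
    apply/orP; right; apply: leq_trans (leq_pmull _ bad_gt0).
    rewrite -[G ^ r]muln1 -lsum_const; apply: leq_lsum => l' _ _.
    exact: leq_b1.
  move/eqP: badl; rewrite addn_eq0 !eqb0 !negbK => /andP[fit gen].
  rewrite (leq_trans _ (leq_addl _ _)) //.
  have rkV j : \rank (stack_unpermuted V0 l j) = k.
    by rewrite (rank_stack_unpermuted fit rkV0) szl.
  apply: leq_trans (lsum_not_arrangeable _ rkV gen len le5L let_n); last by lia.
  rewrite leq_mul2r leq_lsum ?orbT // => l' _ _.
  have := @arrangeable_cat V0 l l' fit.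
  by case: (arrangeable _ l') => [-> //|_]; apply: leq_b1.
(* The first rows contribute [k + q ^ L] and the later ones [r], where [k + r = n <= q ^ L]. *)
have total : lsum (GL F n) n (fun l => ~~ arrangeable V0 l) * q ^ (2 * L)
    <= 2 * q ^ L * G ^ n.
  have -> : lsum (GL F n) n (fun l => ~~ arrangeable V0 l)
      = lsum (GL F n) (k + r) (fun l => ~~ arrangeable V0 l) by rewrite -defn.
  rewrite lsum_cat -lsumMr.
  apply: leq_trans (leq_lsum (fun l szl _ => bad_or_late l szl)) _.
  rewrite lsumD lsumMr lsum_const lsumD -/G.
  have {}bad2 := leq_mul bad2 (leqnn (q ^ L)).
  rewrite -mulnA -expnD addnn -mul2n in bad2.
  have -> : G ^ n = G ^ k * G ^ r by rewrite -expnD -defn.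
  rewrite (mulnC (G ^ r)) mulnA mulnDl mulnCA mulnA -mulnDl -/G in bad1 bad2 *.
  rewrite (mulnA (2 * q ^ L)) leq_mul2r; apply/orP; right.
  apply: leq_trans (leq_add (leq_add bad1 bad2) (leqnn _)) _.
  have : k + r <= q ^ L by rewrite -defn.
  move: (q ^ L) (G ^ k) => Q g; nia.
rewrite -(leq_pmul2r (q0 L)).
apply: (@leq_trans (2 * q ^ L * G ^ n)); last by rewrite mulnAC.
apply: leq_trans total; rewrite -mulnA leq_mul2l mul2n -addnn expnD.
by rewrite leq_mul2r len !orbT.
Qed.

End Arrangement.

(** * From matrices to bases *)

Section Bases.

Variables (F : finFieldType) (n : nat).
Implicit Types (A : 'M[F]_n) (l : seq 'M[F]_n).

Lemma is_basis_rows A : is_basis [seq row i A | i <- enum 'I_n] = (A \in unitmx).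
Proof.
rewrite /is_basis basisEdim size_map size_enum_ord dimvf /dim /= mul1n leqnn andbT.
rewrite -row_full_unit; apply/idP/idP => [/subvP spanA | /row_fullP[A' A'A]].
  rewrite -sub1mx; apply/row_subP => i.
  have := spanA (row i 1%:M)%R (memvf _).
  have -> : [seq row i A | i <- enum 'I_n] = [tuple row i A | i < n] :> seq _ by [].
  move=> /coord_span->; apply: summx_sub => j _; apply: scalemx_sub.
  by rewrite (nth_map j) ?size_enum_ord // nth_ord_enum row_sub.
apply/subvP => v _; rewrite -(mulmx1 v) -A'A mulmxA mulmx_sum_row.
apply: memv_suml => i _; apply/memvZ/memv_span/map_f; exact: mem_enum.
Qed.

Lemma unitmx_row_inj A : A \in unitmx -> injective (fun i => row i A).
Proof.
move=> uA i j /(congr1 (mulmx^~ (invmx A))); rewrite -!row_mul mulmxV //.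
move/rowP/(_ i); rewrite !mxE eqxx; case: eqP => [//|_ /eqP].
by rewrite oner_eq0.
Qed.

Definition row_set A : {set 'rV[F]_n} := [set row i A | i : 'I_n].

Lemma row_set_basis A : A \in GL F n -> row_set A \in bases F n.
Proof.
rewrite !inE => uA; move: (uA); rewrite -is_basis_rows /is_basis.
rewrite -(@perm_basis _ _ (enum (row_set A))) //.
apply: uniq_perm; first exact: enum_uniq.
  by rewrite (map_inj_uniq (unitmx_row_inj uA)) enum_uniq.
move=> v; rewrite mem_enum; apply/imsetP/mapP => [[i _ ->]|[i _ ->]]; exists i => //.
exact: mem_enum.
Qed.

Lemma basis_row_set (B : {set 'rV[F]_n}) : B \in bases F n -> exists2 A, A \in GL F n & row_set A = B.
Proof.
rewrite inE => basisB.
have szB : size (enum B) = n.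
  have := size_basis (basisB : basis_of _ (in_tuple (enum B))).
  by rewrite dimvf /dim /= mul1n.
pose A : 'M[F]_n := (\matrix_i nth 0 (enum B) i)%R.
have rowsA : [seq row i A | i <- enum 'I_n] = enum B.
  apply: (@eq_from_nth _ 0%R); rewrite size_map size_enum_ord ?szB // => i ltin.
  by rewrite (nth_map (Ordinal ltin)) ?size_enum_ord // rowK nth_enum_ord.
exists A; first by rewrite inE -is_basis_rows rowsA.
apply/setP => v; rewrite -[RHS]mem_enum -rowsA.
by apply/imsetP/mapP => [[i _ ->]|[i _ ->]]; exists i => //; apply: mem_enum.
Qed.

(** The matrices in the fibre are the row permutations of one of them, all distinct because an
    invertible matrix has distinct rows. *)
Lemma card_row_set_fiber (B : {set 'rV[F]_n}) :
  B \in bases F n -> #|[set A in GL F n | row_set A == B]| = n`!.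
Proof.
case/basis_row_set => A; rewrite inE => uA <- {B}.
have rowP s i : row i (row_perm s A) = row (s i) A by apply/matrixP => ? ?;
  rewrite !mxE.
have permI : injective (fun s : 'S_n => row_perm s A).
  move=> s s' /= eq_s; apply/permP => i; apply: (unitmx_row_inj uA).
  by rewrite -!rowP eq_s.
rewrite -(card_Sn n) -cardsT -(card_imset _ permI); apply: eq_card => A'.
rewrite !inE; apply/andP/imsetP => [[uA' /eqP eqA']|[s _ ->]]; last first.
  rewrite row_permE unitmx_mul unitmx_perm uA -row_permE; split=> //.
  apply/eqP/setP => v; apply/imsetP/imsetP => [[i _ ->]|[i _ ->]].
    by exists (s i); rewrite ?rowP.
  by exists (s^-1%g i); rewrite ?rowP ?permKV.
have /fin_all_exists[f fP] i : exists j, row i A' = row j A.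
  have : row i A' \in row_set A by rewrite -eqA'; apply: imset_f.
  by case/imsetP => j _ ->; exists j.
have fI : injective f.
  by move=> i i' eqf; apply: (unitmx_row_inj uA'); rewrite !fP eqf.
exists (perm fI) => //; apply/row_matrixP => i.
by rewrite rowP permE fP.
Qed.

Lemma card_GL_bases : #|GL F n| = #|bases F n| * n`!.
Proof.
rewrite -sum1_card (partition_big row_set [in bases F n]) => [|A]; last first.
  exact: row_set_basis.
under eq_bigr => B basisB do rewrite sum1dep_card card_row_set_fiber //.
by rewrite sum_nat_const.
Qed.

(** * From an arrangement to a transversal partition *)

Lemma arrangeableP V l :
    arrangeable V l ->
  exists s : nat -> 'S_n, forall j,
    \rank (V j + \sum_(i < size l) <<row (s i j) (nth 0%R l i)>>)%MS
      = \rank (V j) + size l.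
Proof.
elim: l V => [|A l IH] V /=.
  by exists (fun=> 1%g) => j; rewrite big_ord0 addsmx0 addn0.
case/existsP => s /andP[fit /IH[s' rk_s']].
exists (fun i => if i is i'.+1 then s' i' else s) => j.
rewrite big_ord_recl /= addsmxA rk_s' -addSnnS; congr (_ + _).
apply/eqP; rewrite eqn_leq; apply/andP; split.
  apply: leq_trans (mxrank_adds_leqif _ _).1 _.
  by rewrite -[(\rank _).+1]addn1 leq_add2l mxrank_gen rank_rV leq_b1.
rewrite (ltn_leqif (mxrank_leqif_sup (addsmxSl _ _))).
apply: contra (forallP fit j) => /(submx_trans (addsmxSr _ _)).
by rewrite genmxE.
Qed.

(** The part [S j] collects the copies placed in column [j]. As [s i] is a permutation and the rows
    of each matrix are distinct, every copy lies in exactly one part. *)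
Lemma arrangeable_transversal (t : n.-tuple 'M[F]_n) :
    0 < n -> all [in GL F n] t -> arrangeable (fun=> 0%R) t ->
  transversal_partitionable [ffun i => row_set (tnth t i)].
Proof.
move=> n_gt0 /all_tnthP unit_t /arrangeableP[s rk_s].
have {}unit_t i : tnth t i \in unitmx by have := unit_t i; rewrite inE.
pose r (i j : 'I_n) := row (s i j) (tnth t i).
have rI i : injective (r i).
  by move=> j j' /(unitmx_row_inj (unit_t i)) /perm_inj.
pose C j : 'M[F]_n := (\matrix_i r i j)%R.
have unitC j : C j \in unitmx.
  rewrite -row_full_unit -col_leq_rank.
  have := rk_s j; rewrite size_tuple adds0mx mxrank0 add0n => {1}<-.
  apply: mxrankS; apply/sumsmx_subP => i _; rewrite genmxE.
  by rewrite -tnth_nth -[row _ _](rowK (fun i => r i j) i) row_sub.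
pose S j := [set (i, r i j) | i : 'I_n].
have inS i v j : ((i, v) \in S j) = (v == r i j).
  by apply/imsetP/eqP => [[i' _ [-> ->]]|->] //; exists i.
have S_meet i v j j' : (i, v) \in S j -> (i, v) \in S j' -> j = j'.
  by rewrite !inS => /eqP-> /eqP/rI.
have SI : injective S.
  move=> j j' eqS; pose i0 := Ordinal n_gt0.
  by apply: (S_meet i0 (r i0 j)); [|rewrite -eqS]; rewrite inS.
apply/existsP; exists [set S j | j : 'I_n]; apply/and3P; split; last first.
- apply/forall_inP => _ /imsetP[j _ ->]; apply/andP; split; last first.
    apply/forallP => i; apply/cards1P; exists (i, r i j).
    apply/setP => -[i' v]; rewrite in_set inS in_set1 xpair_eqE /=.
    by apply/andP/andP => -[/eqP-> /eqP->]; rewrite !eqxx.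
  have := unitC j; rewrite -is_basis_rows /is_basis; set X := map _ _.
  rewrite -(@perm_basis _ _ [seq p.2 | p <- enum (S j)]) //.
  have -> : X = [seq p.2 | p <- [seq (i, r i j) | i <- enum 'I_n]].
    by rewrite -map_comp; apply: eq_map => i; rewrite rowK.
  apply/perm_map/uniq_perm; first exact: enum_uniq.
    by rewrite map_inj_uniq ?enum_uniq // => i i' [].
  move=> p; rewrite mem_enum; apply/imsetP/mapP => [[i _ ->]|[i _ ->]]; exists i => //.
  exact: mem_enum.
- by rewrite card_imset // card_ord.
apply/and3P; split.
- rewrite /cover; apply/eqP/setP => -[i v].
  rewrite in_set /= ffunE; apply/bigcupP/imsetP => [[_ /imsetP[j _ ->]]|[k _ ->]].
    by rewrite inS => /eqP->; exists (s i j).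
  exists (S ((s i)^-1%g k)); first exact: imset_f.
  by rewrite inS /r permKV.
- apply/trivIsetP => _ _ /imsetP[j _ ->] /imsetP[j' _ ->] neqS.
  apply/pred0P => -[i v] /=; apply/negP => /andP[inj inj'].
  by rewrite (S_meet _ _ _ _ inj inj') eqxx in neqS.
apply/imsetP => -[j _] /setP/(_ (Ordinal n_gt0, r (Ordinal n_gt0) j)).
by rewrite in_set0 inS eqxx.
Qed.

(** The fibre size is the same for every [B], so uniform tuples of invertible matrices induce
    uniform tuples of bases. *)
Lemma card_tuple_fiber (B : {ffun 'I_n -> {set 'rV[F]_n}}) :
    B \in ffun_on [in bases F n] ->
  #|[set t : n.-tuple 'M[F]_n | all [in GL F n] t
      & [ffun i => row_set (tnth t i)] == B]| = n`! ^ n.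
Proof.
move=> /ffun_onP basisB.
transitivity (\prod_(i < n) #|[set A in GL F n | row_set A == B i]|); last first.
  by under eq_bigr do rewrite card_row_set_fiber //; rewrite prod_nat_const card_ord.
rewrite -sum1dep_card; under [RHS]eq_bigr do rewrite -sum1dep_card.
rewrite bigA_distr_big_dep /=.
rewrite [RHS](reindex (fun t : n.-tuple 'M[F]_n => [ffun i => tnth t i])) /=.
  rewrite [RHS](eq_bigr (fun=> 1)) => [|t _]; last by rewrite big1.
  apply: eq_bigl => t; apply/andP/familyP => [[/all_tnthP GLt /eqP/ffunP tB] i|tB].
    rewrite ffunE; apply/andP; split; first exact: GLt.
    by have := tB i; rewrite ffunE => ->.
  split; first by apply/all_tnthP => i; have := tB i; rewrite ffunE => /andP[].
  by apply/eqP/ffunP => i; rewrite ffunE; have := tB i; rewrite ffunE => /andP[_ /eqP].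
exists (fun f : {ffun 'I_n -> 'M[F]_n} => [tuple f i | i < n]) => [t _|f _].
  by apply: eq_from_tnth => i; rewrite tnth_mktuple ffunE.
by apply/ffunP => i; rewrite ffunE tnth_mktuple.
Qed.

Lemma card_not_transversal_partitionable L :
    0 < L -> n <= #|F| ^ L -> 1024 * (L * L) <= n ->
  #|[set B in ffun_on [in bases F n] | ~~ @transversal_partitionable F n B]| * n
    <= 2 * #|bases F n| ^ n.
Proof.
move=> L_gt0 len leL.
have n_gt0 : 0 < n by nia.
have := lsum_not_arrangeable0 L_gt0 len leL.
rewrite card_GL_bases expnMn mulnA => le_arr.
rewrite -(@leq_pmul2r (n`! ^ n)); last by rewrite expn_gt0 fact_gt0.
apply: leq_trans le_arr; rewrite mulnAC leq_mul2r; apply/orP; right.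
rewrite lsum_tuple -sum_nat_const.
rewrite (eq_bigr (fun B => \sum_(t : n.-tuple 'M[F]_n | all [in GL F n] t
    && ([ffun i => row_set (tnth t i)] == B)) 1)); last first.
  by move=> B; rewrite inE => /andP[basisB _]; rewrite sum1dep_card card_tuple_fiber.
pose bad t := ~~ transversal_partitionable [ffun i => row_set (tnth t i)].
apply: (@leq_trans (\sum_(t : n.-tuple 'M[F]_n | all [in GL F n] t && bad t) 1)).
  rewrite [X in _ <= X](partition_big (fun t => [ffun i => row_set (tnth t i)])
    [in [set B in ffun_on [in bases F n] | ~~ @transversal_partitionable F n B]]).
    apply: leq_sum => B; rewrite inE => /andP[_ badB].
    rewrite !sum1dep_card; apply/subset_leq_card/subsetP => t; rewrite !inE /bad.
    by move=> /andP[-> /eqP->]; rewrite badB eqxx.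
  move=> t /andP[/all_tnthP GLt bad_t]; rewrite inE; apply/andP; split=> //.
  by apply/ffun_onP => i; rewrite ffunE row_set_basis.
rewrite big_mkcondr; apply: leq_sum => t GLt; rewrite /bad.
case: ifPn => // /(contra (arrangeable_transversal n_gt0 GLt)).
by case: arrangeable.
Qed.

End Bases.

(** * The limit *)

From mathcomp Require Import all_classical all_reals all_analysis.
Import numFieldNormedType.Exports.

(** At [L = 32] this reads [2 ^ 20 <= 2 ^ 31]; from then on, incrementing [L] less than doubles
    [L * L]. *)
Lemma sqr_leq_exp2 L : 32 <= L -> 2 ^ 10 * (L * L) <= 2 ^ L.-1.
Proof.
move/subnKC <-; elim: (L - 32) => [|d IH].
  by rewrite addn0 -[32]/(2 ^ 5) -!expnD leq_exp2l.
move: IH;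
  rewrite addnS -[(32 + d).+1.-1]/(31 + d).+1 -[(32 + d).-1]/(31 + d) (expnS 2 (31 + d)).
move: (2 ^ 10) (2 ^ (31 + d)) (32 + d) (leq_addr d 32) => c X L' leL' IH.
apply: leq_trans (leq_mul (leqnn 2) IH); rewrite [X in _ <= X]mulnCA leq_mul2l.
by apply/orP; right; nia.
Qed.

Lemma log_scale_exists q n : 1 < q -> 2 ^ 31 <= n ->
  exists L, [/\ 0 < L, n <= q ^ L & 1024 * (L * L) <= n].
Proof.
move=> q1 len; have n_gt0 : 0 < n by apply: leq_trans len; rewrite expn_gt0.
(* With this [L], [2 ^ L.-1 <= n < 2 ^ L], and [2 ^ 31 <= n] gives [L >= 32]. *)
exists (trunc_log 2 n).+1; split=> //.
  apply: leq_trans (ltnW (trunc_log_ltn n (leqnn 2))) _; exact: leq_wexp2r.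
apply: leq_trans (trunc_logP (leqnn 2) n_gt0).
by apply: (@sqr_leq_exp2 (trunc_log 2 n).+1); rewrite ltnS; apply: trunc_log_max.
Qed.

Local Open Scope ring_scope.

(** * Probabilities as ratios of cardinalities *)

Section Probability.

Variables (R : realFieldType) (F : finFieldType) (n : nat).
Implicit Types (E : pred {ffun 'I_n -> {set 'rV[F]_n}}).

Lemma card_bases_gt0 : (0 < #|bases F n|)%N.
Proof.
apply/card_gt0P; exists (row_set (1%:M : 'M[F]_n)).
by apply: row_set_basis; rewrite inE unitmx1.
Qed.

Lemma prob_random_basesC E :
  prob_random_bases R E = 1 - prob_random_bases R (predC E).
Proof.
rewrite /prob_random_bases /=.
have total : \sum_(B : {ffun 'I_n -> {set 'rV[F]_n}})
    \prod_(i < n) uniform_pmf R (bases F n) (B i) = 1.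
  rewrite -(bigA_distr_bigA (fun _ => uniform_pmf R (bases F n))) big1 // => i _.
  rewrite -big_mkcond sumr_const -[LHS]mulr_natr mulVf //.
  by rewrite pnatr_eq0 -lt0n card_bases_gt0.
by apply/eqP; rewrite eq_sym subr_eq; apply/eqP; rewrite -[LHS]total (bigID E).
Qed.

Lemma prob_random_basesE E :
  prob_random_bases R E
    = #|[set B in ffun_on [in bases F n] | E B]|%:R / #|bases F n|%:R ^+ n.
Proof.
rewrite mulr_natl -sumr_const /prob_random_bases big_mkcond [RHS]big_mkcond /=.
apply: eq_bigr => B _; rewrite inE andbC; case: (E B) => //=.
have [/ffun_onP basisB|/ffun_onP notB] := boolP (B \in _).
  under eq_bigr do rewrite /uniform_pmf basisB.
  by rewrite prodr_const card_ord exprVn.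
have [i notBi] : exists i, B i \notin bases F n.
  by apply/existsP; rewrite -negb_forall; apply/negP => /forallP.
by rewrite (bigD1 i) //= /uniform_pmf (negPf notBi) mul0r.
Qed.

Lemma prob_random_bases_ge0 E : 0 <= prob_random_bases R E.
Proof. by rewrite prob_random_basesE divr_ge0 ?exprn_ge0. Qed.

End Probability.

Local Open Scope classical_set_scope.
Local Open Scope ring_scope.

Theorem theorem1p2 (R : realType) (F : finFieldType) :
  prob_random_bases R (@transversal_partitionable F n) @[n --> \oo] --> (1 : R).
Proof.
apply/cvgrPdist_le => e e_gt0; near=> n.
rewrite prob_random_basesC opprB addrC subrK ger0_norm ?prob_random_bases_ge0 //.
have [L [L_gt0 len leL]] : exists L, [/\ (0 < L)%N, (n <= #|F| ^ L)%N & (1024 * (L * L) <= n)%N].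
  apply: log_scale_exists (card_F_gt1 F) _; near: n; exact: nbhs_infty_ge.
have n_gt0 : (0 < n)%N by nia.
have := card_not_transversal_partitionable L_gt0 len leL.
rewrite -(ler_nat R) !natrM natrX => le_bad.
rewrite prob_random_basesE ler_pdivrMr ?exprn_gt0 ?ltr0n ?card_bases_gt0 //.
(* The failure probability is at most [2 / n], so [n >= 2 / e] suffices. *)
have le2n : 2 <= e * n%:R.
  rewrite mulrC -ler_pdivrMr //; near: n; exact: nbhs_infty_ger.
rewrite -(@ler_pM2r _ n%:R) ?ltr0n //; apply: le_trans le_bad _.
by rewrite mulrAC ler_wpM2r // exprn_ge0.
Unshelve. all: by end_near.
Qed.
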